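(* Let $k:A\to B$ be a homomorphism of weak Hopf algebras over a field $\mathbb{F}$, with $A$ connected, and let $\pi:B\to H$ be the cokernel of $k$. Then $\pi$ is surjective, i.e. $\mathrm{im}\,\pi=H$.
   Context: Fix a field $\mathbb{F}$. Sweedler notation without summation sign is used: $\Delta(a)=a^{(1)}\otimes a^{(2)}$. A weak Hopf algebra is a unital associative algebra $A$ that is also a coassociative counital coalgebra, with a linear map $S:A\to A$, such that for all $a,b,c\in A$: $\Delta(ab)=\Delta(a)\Delta(b)$; $(\Delta\otimes\mathrm{id})\Delta(1)=(\Delta(1)\otimes 1)(1\otimes\Delta(1))=(1\otimes\Delta(1))(\Delta(1)\otimes 1)$; $\epsilon(abc)=\epsilon(ab^{(1)})\epsilon(b^{(2)}c)=\epsilon(ab^{(2)})\epsilon(b^{(1)}c)$; $a^{(1)}S(a^{(2)})=\epsilon(1^{(1)}a)1^{(2)}$; $S(a^{(1)})a^{(2)}=1^{(1)}\epsilon(a1^{(2)})$; $S(a^{(1)})a^{(2)}S(a^{(3)})=S(a)$. Put $\epsilon_t(a)=a^{(1)}S(a^{(2)})$ and $A_t=\epsilon_t(A)$, which is an $A$-module via $a\cdot x=\epsilon_t(ax)$. $A$ is connected if it satisfies the following conditions (treated as equivalent): $A_t$ is a simple $A$-module; $Z(A)\cap A_t=\mathbb{F}1_A$; $\mathrm{End}_A(A_t)=\mathbb{F}\,\mathrm{id}_{A_t}$. A weak Hopf algebra homomorphism is a unital algebra homomorphism that is a counital coalgebra homomorphism and commutes with antipodes. A linear map $\pi:B\to C$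 from a weak Hopf algebra to an associative algebra is birelatively multiplicative if $\pi(aS(1^{(1)}))\pi(1^{(2)}b)=\pi(ab)=\pi(a1^{(1)})\pi(S(1^{(2)})b)$ for all $a,b\in B$. The cokernel of $k:A\to B$ is the universal pair $(H,\pi)$ where $H$ is a unital associative algebra and $\pi:B\to H$ is birelatively multiplicative with $\pi(k(a))=\epsilon_A(a)1_H$ for all $a\in A$; universal means every other such pair $(H',\pi')$ is $\pi'=\gamma\circ\pi$ for a unique unital algebra homomorphism $\gamma:H\to H'$. (It always exists, and $H$ is a Hopf algebra.) *)

(* Defs.v *)
From HB Require Import structures.
From mathcomp Require Import all_boot all_order all_algebra.
From mathcomp Require Import generic_quotient.
From mathcomp Require Import boolp classical_sets.

Set Implicit Arguments.
Unset Strict Implicit.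
Unset Printing Implicit Defensive.

Import GRing.Theory.
Local Open Scope ring_scope.
Local Open Scope quotient_scope.
Local Open Scope classical_set_scope.

Reserved Notation "u ⊗ v" (at level 40, left associativity).
Reserved Notation "\tsum_ ( x , y <- t ) E"
  (at level 41, x name, y name, t at level 200, E at level 41,
   format "'[' \tsum_ ( x ,  y  <-  t ) '/  '  E ']'").

(* The tensor product of two vector spaces: finite formal sums of pairs (u, v),
   modulo the congruence generated by the bilinearity relations.  Scalars are
   absorbed into the entries of the pairs. *)
Section TensorProduct.
Variables (F : fieldType) (U V : lmodType F).

Inductive tens_cong : seq (U * V) -> seq (U * V) -> Prop :=
| tens_refl s : tens_cong s s
| tens_sym s t : tens_cong s t -> tens_cong t s
| tens_trans s t r : tens_cong s t -> tens_cong t r -> tens_cong s r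
| tens_cat s s' t t' :
    tens_cong s s' -> tens_cong t t' -> tens_cong (s ++ t) (s' ++ t')
| tens_catC s t : tens_cong (s ++ t) (t ++ s)
| tens_addl u u' v : tens_cong [:: (u + u', v)] [:: (u, v); (u', v)]
| tens_addr u v v' : tens_cong [:: (u, v + v')] [:: (u, v); (u, v')]
| tens_scale c u v : tens_cong [:: (c *: u, v)] [:: (u, c *: v)]
| tens_zero v : tens_cong [:: (0, v)] [::].

Definition tens_rel (s t : seq (U * V)) : bool := `[< tens_cong s t >].

Lemma tens_relP : equiv_class_of tens_rel.
Proof.
split=> [s|s t|s t r].
- exact/asboolP/tens_refl.
- by apply/asboolP/asboolP => /tens_sym.
- move=> /asboolP st /asboolP tr; apply/asboolP; exact: tens_trans st tr.
Qed.

Canonical tens_equiv := EquivRelPack tens_relP.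

Definition tensor : Type := {eq_quot tens_equiv}.
HB.instance Definition _ := Choice.on tensor.

Definition to_tensor (s : seq (U * V)) : tensor := \pi_({eq_quot tens_equiv}) s.
Definition of_tensor (t : tensor) : seq (U * V) :=
  repr (t : {eq_quot tens_equiv}).

Lemma of_tensorK : cancel of_tensor to_tensor.
Proof. by move=> t; rewrite /to_tensor /of_tensor reprK. Qed.

Lemma to_tensorP s t : tens_cong s t <-> to_tensor s = to_tensor t.
Proof.
split=> [st|/eqmodP/asboolP //].
by apply/eqmodP/asboolP.
Qed.

Lemma to_tensorK s : tens_cong (of_tensor (to_tensor s)) s.
Proof. by apply/to_tensorP; rewrite of_tensorK. Qed.

Lemma tens_cong_flatten (I : Type) (f g : I -> seq (U * V)) (s : seq I) :
  (forall i, tens_cong (f i) (g i)) ->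
  tens_cong (flatten (map f s)) (flatten (map g s)).
Proof.
by move=> fg; elim: s => [|i s IHs] /=; [exact: tens_refl|exact: tens_cat].
Qed.

Definition scale_pairs (c : F) (s : seq (U * V)) : seq (U * V) :=
  [seq (c *: p.1, p.2) | p <- s].

Lemma scale_pairs_cong c s t :
  tens_cong s t -> tens_cong (scale_pairs c s) (scale_pairs c t).
Proof.
elim=> [r|r r' _ /tens_sym //|r r' r'' _ h _ h'|r r' r1 r1' _ h _ h'|r r'
       |u u' v|u v v'|d u v|v].
- exact: tens_refl.
- exact: tens_trans h h'.
- by rewrite /scale_pairs !map_cat; apply: tens_cat.
- by rewrite /scale_pairs !map_cat; apply: tens_catC.
- by rewrite /= scalerDr; apply: tens_addl.
- exact: tens_addr.
- by rewrite /= scalerA mulrC -scalerA; apply: tens_scale.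
- by rewrite /= scaler0; apply: tens_zero.
Qed.

Definition tensor_zero : tensor := to_tensor [::].
Definition tensor_add (s t : tensor) : tensor :=
  to_tensor (of_tensor s ++ of_tensor t).
Definition tensor_scale (c : F) (t : tensor) : tensor :=
  to_tensor (scale_pairs c (of_tensor t)).
Definition tensor_opp (t : tensor) : tensor := tensor_scale (-1) t.

Lemma tensor_add_to s t :
  tensor_add (to_tensor s) (to_tensor t) = to_tensor (s ++ t).
Proof. by apply/to_tensorP/tens_cat; exact: to_tensorK. Qed.

Lemma tensor_scale_to c s :
  tensor_scale c (to_tensor s) = to_tensor (scale_pairs c s).
Proof. by apply/to_tensorP/scale_pairs_cong/to_tensorK. Qed.

Lemma tensor_addA : associative tensor_add.
Proof.
move=> s t r; rewrite -(of_tensorK s) -(of_tensorK t) -(of_tensorK r).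
by rewrite !tensor_add_to catA.
Qed.

Lemma tensor_addC : commutative tensor_add.
Proof. by move=> s t; apply/to_tensorP/tens_catC. Qed.

Lemma tensor_add0 : left_id tensor_zero tensor_add.
Proof. by move=> s; rewrite -(of_tensorK s) tensor_add_to. Qed.

Lemma tensor_scaleDl (t : tensor) (a b : F) :
  tensor_scale (a + b) t = tensor_add (tensor_scale a t) (tensor_scale b t).
Proof.
rewrite -(of_tensorK t) !tensor_scale_to tensor_add_to; apply/to_tensorP.
elim: (of_tensor t) => [|[u v] s IHs] /=; first exact: tens_refl.
rewrite scalerDl -cat1s.
apply: tens_trans (tens_cat (tens_addl _ _ _) IHs) _.
apply: (@tens_cat [:: _] [:: _] (_ :: _ ++ _)); first exact: tens_refl.
rewrite -(cat1s _ (scale_pairs b s)) catA.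
exact: tens_cat (tens_catC [:: _] _) (tens_refl _).
Qed.

Lemma tensor_scale0 (t : tensor) : tensor_scale 0 t = tensor_zero.
Proof.
rewrite -(of_tensorK t) tensor_scale_to; apply/to_tensorP.
elim: (of_tensor t) => [|[u v] s IHs] /=; first exact: tens_refl.
by rewrite scale0r -cat1s -[[::]]cats0; apply: tens_cat IHs; apply: tens_zero.
Qed.

Lemma tensor_scaleA a b (t : tensor) :
  tensor_scale a (tensor_scale b t) = tensor_scale (a * b) t.
Proof.
rewrite -(of_tensorK t) !tensor_scale_to /scale_pairs -map_comp.
by congr to_tensor; apply: eq_map => p /=; rewrite scalerA.
Qed.

Lemma tensor_scale1 : left_id 1 tensor_scale.
Proof.
move=> t; rewrite -(of_tensorK t) tensor_scale_to /scale_pairs.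
by rewrite (eq_map (_ : _ =1 id)) ?map_id // => -[u v] /=; rewrite scale1r.
Qed.

Lemma tensor_scaleDr : right_distributive tensor_scale tensor_add.
Proof.
move=> c s t; rewrite -(of_tensorK s) -(of_tensorK t).
by rewrite tensor_add_to !tensor_scale_to tensor_add_to /scale_pairs map_cat.
Qed.

Lemma tensor_addN : left_inverse tensor_zero tensor_opp tensor_add.
Proof.
move=> t; rewrite -{2}(tensor_scale1 t) -tensor_scaleDl addNr.
exact: tensor_scale0.
Qed.

HB.instance Definition _ :=
  GRing.isZmodule.Build tensor tensor_addA tensor_addC tensor_add0 tensor_addN.
HB.instance Definition _ :=
  GRing.Zmodule_isLmodule.Build F tensor
    tensor_scaleA tensor_scale1 tensor_scaleDr tensor_scaleDl.

Definition tens (u : U) (v : V) : tensor := to_tensor [:: (u, v)].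

(* Meaningful only when f is bilinear: the choice of the representative is then
   irrelevant (see tsum_to and tsum_tens), and tsum f is the linear map on the
   tensor product induced by f. *)
Definition tsum (W : nmodType) (f : U -> V -> W) (t : tensor) : W :=
  \sum_(p <- of_tensor t) f p.1 p.2.

Definition bilin (W : lmodType F) (f : U -> V -> W) : Prop :=
  bilinear_for ( *:%R : F -> W -> W) ( *:%R : F -> W -> W) f.

End TensorProduct.

Notation "u ⊗ v" := (tens u v) : ring_scope.
Notation "\tsum_ ( x , y <- t ) E" := (tsum (fun x y => E) t) : ring_scope.

Section TensorTheory.
Variables (F : fieldType) (U V : lmodType F).
Implicit Types (t : tensor U V).

Lemma to_tensorD s s' :
  to_tensor (s ++ s') = to_tensor s + to_tensor s' :> tensor U V.
Proof. by rewrite -tensor_add_to. Qed.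

Lemma tens_bilin : bilin (@tens F U V).
Proof.
have zr (u : U) (v : V) : (0 : U) ⊗ v = 0 by apply/to_tensorP/tens_zero.
have dl u u' v : (u + u') ⊗ v = u ⊗ v + u' ⊗ v :> tensor U V.
  by rewrite /tens -to_tensorD; apply/to_tensorP/tens_addl.
have dr u v v' : u ⊗ (v + v') = u ⊗ v + u ⊗ v' :> tensor U V.
  by rewrite /tens -to_tensorD; apply/to_tensorP/tens_addr.
have zl c u v : (c *: u) ⊗ v = c *: (u ⊗ v) :> tensor U V.
  rewrite /tens; symmetry; apply: tensor_scale_to.
have zlr c u v : (c *: u) ⊗ v = u ⊗ (c *: v) :> tensor U V.
  by apply/to_tensorP/tens_scale.
by split=> [v c u u'|u c v v']; rewrite ?dl ?dr ?zl // -zlr zl.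
Qed.

Lemma tensorE t : t = \sum_(p <- of_tensor t) p.1 ⊗ p.2.
Proof.
rewrite -{1}(of_tensorK t); elim: (of_tensor t) => [|[u v] s IHs].
  by rewrite big_nil.
by rewrite big_cons -cat1s to_tensorD IHs.
Qed.

Lemma tensor_ind (P : tensor U V -> Prop) :
  (forall s t, P s -> P t -> P (s + t)) -> (forall u v, P (u ⊗ v)) ->
  forall t, P t.
Proof.
move=> PD Pt t; rewrite (tensorE t).
elim: (of_tensor t) => [|p s IHs]; last by rewrite big_cons; apply: PD.
rewrite big_nil (_ : 0 = (0 : U) ⊗ (0 : V)) //.
by symmetry; apply/to_tensorP/tens_zero.
Qed.

Section Lift.
Variables (W : lmodType F) (f : U -> V -> W).
Hypothesis f_bilin : bilin f.

Lemma bilinDl u u' v : f (u + u') v = f u v + f u' v.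
Proof. by have /= := f_bilin.1 v 1 u u'; rewrite !scale1r. Qed.
Lemma bilinDr u v v' : f u (v + v') = f u v + f u v'.
Proof. by have /= := f_bilin.2 u 1 v v'; rewrite !scale1r. Qed.
Lemma bilin0l v : f 0 v = 0.
Proof. by apply: (@addrI _ (f 0 v)); rewrite -bilinDl !addr0. Qed.
Lemma bilin0r u : f u 0 = 0.
Proof. by apply: (@addrI _ (f u 0)); rewrite -bilinDr !addr0. Qed.
Lemma bilinZl c u v : f (c *: u) v = c *: f u v.
Proof. by have /= := f_bilin.1 v c u 0; rewrite !addr0 bilin0l addr0. Qed.
Lemma bilinZr c u v : f u (c *: v) = c *: f u v.
Proof. by have /= := f_bilin.2 u c v 0; rewrite !addr0 bilin0r addr0. Qed.

Lemma tsum_cong s s' : tens_cong s s' ->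
  \sum_(p <- s) f p.1 p.2 = \sum_(p <- s') f p.1 p.2.
Proof.
elim=> {s s'} [//|s t _ //|s t r _ -> _ -> //|s s' t t' _ IH _ IH'|s t
       |u u' v|u v v'|c u v|v].
- by rewrite !big_cat /= IH IH'.
- by rewrite !big_cat /= addrC.
- by rewrite !big_cons !big_nil /= !addr0 bilinDl.
- by rewrite !big_cons !big_nil /= !addr0 bilinDr.
- by rewrite !big_cons !big_nil /= !addr0 bilinZl bilinZr.
- by rewrite !big_cons !big_nil /= !addr0 bilin0l.
Qed.

Lemma tsum_to s : tsum f (to_tensor s) = \sum_(p <- s) f p.1 p.2.
Proof. exact/tsum_cong/to_tensorK. Qed.

Lemma tsum_tens u v : tsum f (u ⊗ v) = f u v.
Proof. by rewrite /tens tsum_to big_cons big_nil addr0. Qed.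

Lemma tsum_linear : linear (tsum f).
Proof.
move=> c s t.
have -> : c *: s + t = to_tensor (scale_pairs c (of_tensor s) ++ of_tensor t).
  by rewrite to_tensorD of_tensorK.
rewrite tsum_to big_cat /= /scale_pairs big_map /= /tsum scaler_sumr.
by congr (_ + _); apply: eq_bigr => p _; rewrite bilinZl.
Qed.

Lemma tsumD s t : tsum f (s + t) = tsum f s + tsum f t.
Proof. by have := tsum_linear 1 s t; rewrite !scale1r. Qed.

Lemma tsum0 : tsum f 0 = 0.
Proof. by apply: (@addrI _ (tsum f 0)); rewrite -tsumD !addr0. Qed.

Lemma tsumZ c t : tsum f (c *: t) = c *: tsum f t.
Proof. by have := tsum_linear c t 0; rewrite !addr0 tsum0 addr0. Qed.

End Lift.
End TensorTheory.

Definition tmap (F : fieldType) (U V U' V' : lmodType F)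
    (f : U -> U') (g : V -> V') (t : tensor U V) : tensor U' V' :=
  \tsum_(u, v <- t) f u ⊗ g v.

Definition tassoc (F : fieldType) (U V W : lmodType F)
    (t : tensor (tensor U V) W) : tensor U (tensor V W) :=
  \tsum_(s, w <- t) \tsum_(u, v <- s) u ⊗ (v ⊗ w).

Section TensorMaps.
Variables (F : fieldType) (U V W U' V' : lmodType F).

Lemma tmap_bilin (f : {linear U -> U'}) (g : {linear V -> V'}) :
  bilin (fun u v => f u ⊗ g v).
Proof.
split=> [v c x y|u c x y] /=; rewrite linearP; first exact: (tens_bilin _ _).1.
exact: (tens_bilin _ _).2.
Qed.

Lemma tmap_tens (f : {linear U -> U'}) (g : {linear V -> V'}) u v :
  tmap f g (u ⊗ v) = f u ⊗ g v.
Proof. by rewrite /tmap tsum_tens //; exact: tmap_bilin. Qed.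

Lemma tassoc_bilin2 (w : W) : bilin (fun (u : U) (v : V) => u ⊗ (v ⊗ w)).
Proof.
split=> [v c x y|u c x y] /=; first exact: (tens_bilin _ _).1.
by rewrite [X in u ⊗ X](tens_bilin _ _).1; exact: (tens_bilin _ _).2.
Qed.

Lemma tassoc_bilin1 :
  bilin (fun (s : tensor U V) (w : W) => \tsum_(u, v <- s) u ⊗ (v ⊗ w)).
Proof.
split=> [w c x y|s c x y] /=; first by rewrite tsum_linear //; exact: tassoc_bilin2.
elim/tensor_ind: s => [s t IH IH'|u v].
  by rewrite !tsumD; try exact: tassoc_bilin2; rewrite IH IH' scalerDr addrACA.
rewrite !tsum_tens; try exact: tassoc_bilin2.
by rewrite (tens_bilin _ _).2 (tens_bilin _ _).2.
Qed.

Lemma tassoc_tens (u : U) (v : V) (w : W) :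
  tassoc ((u ⊗ v) ⊗ w) = u ⊗ (v ⊗ w).
Proof.
by rewrite /tassoc tsum_tens ?tsum_tens //;
  [exact: tassoc_bilin2|exact: tassoc_bilin1].
Qed.

End TensorMaps.

(* A linear form not vanishing at a given nonzero vector, by Zorn's lemma. It is
   needed only to see that the algebra tensor product is a nonzero ring. *)
Lemma linear_form_neq0 (F : fieldType) (V : lmodType F) (v : V) :
  v != 0 -> exists2 f : V -> F, scalar f & f v = 1.
Proof.
move=> v0.
pose P (W : set V) := (forall a x y, W x -> W y -> W (a *: x + y)) /\ ~ W v.
have [] := @Zorn_bigcup V P.
  move=> G GP tot; split=> [a x y [X GX Xx] [Y GY Yy]|[X GX Xv]]; last first.
    by have [] := GP _ GX.
  have [XY|YX] := tot _ _ GX GY.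
    by exists Y => //; apply: (GP _ GY).1 => //; apply: XY.
  by exists X => //; apply: (GP _ GX).1 => //; apply: YX.
move=> W [[Wlin Wv] Wmax].
have W0 : W 0.
  case: (pselect (exists x, W x)) => [[x Wx]|nW].
    by have := Wlin (-1) x x Wx Wx; rewrite scaleN1r addNr.
  exfalso; apply: (Wmax [set 0]); last first.
    split=> [a x y /= -> ->|/= v_0]; first by rewrite scaler0 addr0.
    by rewrite v_0 eqxx in v0.
  split=> [x Wx|]; first by case: nW; exists x.
  by move=> /(_ 0 erefl) Wz; case: nW; exists 0.
have WZ a x : W x -> W (a *: x) by move=> Wx; rewrite -[_ *: _]addr0; apply: Wlin.
have WD x y : W x -> W y -> W (x + y).
  by move=> Wx Wy; rewrite -[x]scale1r; apply: Wlin.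
have WB x y : W x -> W y -> W (x - y).
  by move=> Wx Wy; rewrite -scaleN1r; apply: WD => //; apply: WZ.
have ex x : exists c, W (x - c *: v).
  case: (pselect (W x)) => [Wx|nWx]; first by exists 0; rewrite scale0r subr0.
  pose W' := [set y | exists w, exists2 c, W w & y = w + c *: x].
  have W'v : W' v.
    apply: contrapT => nW'v; apply: (Wmax W'); last first.
      split=> // a _ _ [w [c Ww ->]] [w' [c' Ww' ->]].
      exists (a *: w + w'), (a * c + c'); first exact: Wlin.
      by rewrite scalerDr scalerDl scalerA addrACA.
    split=> [y Wy|W'W]; first by exists y, 0 => //; rewrite scale0r addr0.
    by apply: nWx; apply: W'W; exists 0, 1 => //; rewrite scale1r add0r.
  have [w [c Ww vE]] := W'v.
  have c0 : c != 0.
    by apply/eqP => c0; apply: Wv; rewrite vE c0 scale0r addr0.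
  exists c^-1; rewrite vE scalerDr scalerA mulVf // scale1r opprD addrCA subrr.
  by rewrite addr0 -scaleN1r; apply: (WZ); apply: WZ.
have uniq x c c' : W (x - c *: v) -> W (x - c' *: v) -> c = c'.
  move=> h h'; apply: contrapT => /eqP cc'; apply: Wv.
  have /(WZ (c' - c)^-1) := WB _ _ h h'.
  have -> : x - c *: v - (x - c' *: v) = (c' - c) *: v.
    by rewrite opprB addrC addrA subrK scalerBl.
  rewrite scalerA mulVf ?scale1r //.
  by rewrite subr_eq0 eq_sym.
pose f x := sval (cid (ex x)).
have fP x : W (x - f x *: v) by exact: svalP (cid (ex x)).
exists f; last first.
  by apply: (uniq v) => //; rewrite scale1r subrr.
move=> a x y; apply: (uniq _ _ _ (fP _)).
have -> : a *: x + y - (a * f x + f y) *: v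
   = a *: (x - f x *: v) + (y - f y *: v).
  by rewrite scalerBr scalerDl scalerA opprD addrACA.
exact: Wlin.
Qed.

Section TensorAlgebra.
Variables (F : fieldType) (A B : algType F).
Implicit Types s t r : tensor A B.

Definition tensor_one : tensor A B := 1 ⊗ 1.

Definition tensor_mul s t : tensor A B :=
  \tsum_(a, b <- s) \tsum_(a', b' <- t) (a * a') ⊗ (b * b').

Let tensB := @tens_bilin F A B.

Lemma tensor_mul_bilin2 (a : A) (b : B) :
  bilin (fun a' b' => (a * a') ⊗ (b * b')).
Proof.
split=> [b' c x y|a' c x y] /=; rewrite mulrDr -scalerAr.
  exact: tensB.1.
exact: tensB.2.
Qed.

Lemma tensor_mul_bilin1 t :
  bilin (fun a b => \tsum_(a', b' <- t) (a * a') ⊗ (b * b')).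
Proof.
elim/tensor_ind: t => [s t IHs IHt|a' b'].
  split=> [b c x y|a c x y] /=; rewrite !tsumD;
    do ?exact: tensor_mul_bilin2.
    by rewrite IHs.1 IHt.1 scalerDr addrACA.
  by rewrite IHs.2 IHt.2 scalerDr addrACA.
split=> [b c x y|a c x y] /=; rewrite !tsum_tens;
  do ?exact: tensor_mul_bilin2; rewrite mulrDl -scalerAl.
  exact: tensB.1.
exact: tensB.2.
Qed.

Lemma tensor_mul_tens (a a' : A) (b b' : B) :
  tensor_mul (a ⊗ b) (a' ⊗ b') = (a * a') ⊗ (b * b').
Proof.
rewrite /tensor_mul tsum_tens; last exact: tensor_mul_bilin1.
by rewrite tsum_tens //; exact: tensor_mul_bilin2.
Qed.

Lemma tensor_mulDl : left_distributive tensor_mul +%R.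
Proof. by move=> s t r; apply: tsumD; exact: tensor_mul_bilin1. Qed.

Lemma tensor_scaleAl c s t : c *: tensor_mul s t = tensor_mul (c *: s) t.
Proof. by symmetry; apply: tsumZ; exact: tensor_mul_bilin1. Qed.

Lemma tensor_mulDr : right_distributive tensor_mul +%R.
Proof.
move=> s t r; rewrite /tensor_mul -big_split; apply: eq_bigr => p _.
by rewrite tsumD //; exact: tensor_mul_bilin2.
Qed.

Lemma tensor_scaleAr c s t : c *: tensor_mul s t = tensor_mul s (c *: t).
Proof.
rewrite /tensor_mul [LHS]scaler_sumr; apply: eq_bigr => p _.
by rewrite tsumZ //; exact: tensor_mul_bilin2.
Qed.

Lemma tensor_mulA : associative tensor_mul.
Proof.
move=> s t r; elim/tensor_ind: s => [s s' IH IH'|a b].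
  by rewrite !tensor_mulDl IH IH'.
elim/tensor_ind: t => [t t' IH IH'|a' b'].
  by rewrite !(tensor_mulDl, tensor_mulDr) IH IH'.
elim/tensor_ind: r => [r r' IH IH'|a'' b''].
  by rewrite !tensor_mulDr IH IH'.
by rewrite !tensor_mul_tens !mulrA.
Qed.

Lemma tensor_mul1l : left_id tensor_one tensor_mul.
Proof.
elim/tensor_ind => [s t IHs IHt|a b]; first by rewrite tensor_mulDr IHs IHt.
by rewrite tensor_mul_tens !mul1r.
Qed.

Lemma tensor_mul1r : right_id tensor_one tensor_mul.
Proof.
elim/tensor_ind => [s t IHs IHt|a b]; first by rewrite tensor_mulDl IHs IHt.
by rewrite tensor_mul_tens !mulr1.
Qed.

Lemma tensor_one_neq0 : tensor_one != 0.
Proof.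
have [f flin f1] := linear_form_neq0 (oner_neq0 A).
have [g glin g1] := linear_form_neq0 (oner_neq0 B).
have fg : bilin (fun a b => f a * g b : F^o).
  split=> [b c x y|a c x y] /=.
    by rewrite flin mulrDl -mulrA.
  by rewrite glin mulrDr mulrCA.
apply/eqP => /(congr1 (tsum (fun a b => f a * g b : F^o))).
by rewrite tsum_tens // tsum0 // f1 g1 mulr1 => /eqP; rewrite oner_eq0.
Qed.

HB.instance Definition _ := GRing.Zmodule_isNzRing.Build (tensor A B)
  tensor_mulA tensor_mul1l tensor_mul1r tensor_mulDl tensor_mulDr
  tensor_one_neq0.
HB.instance Definition _ :=
  GRing.Lmodule_isLalgebra.Build F (tensor A B) tensor_scaleAl.
HB.instance Definition _ :=
  GRing.Lalgebra_isAlgebra.Build F (tensor A B) tensor_scaleAr.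

End TensorAlgebra.

HB.mixin Record Algebra_isWeakHopf (F : fieldType) A of GRing.Algebra F A := {
  comul : {linear A -> tensor A A};
  counit : {scalar A};
  antipode : {linear A -> A};
  comul_coassoc : forall a : A,
    tassoc (tmap comul id (comul a)) = tmap id comul (comul a);
  comul_counitl : forall a : A, \tsum_(x, y <- comul a) counit x *: y = a;
  comul_counitr : forall a : A, \tsum_(x, y <- comul a) counit y *: x = a;
  comulM : forall a b : A, comul (a * b) = comul a * comul b;
  comul1_leftright :
    tassoc (tmap comul id (comul 1)) =
    tassoc (comul 1 ⊗ (1 : A)) * ((1 : A) ⊗ comul 1);
  comul1_rightleft :
    tassoc (tmap comul id (comul 1)) =
    ((1 : A) ⊗ comul 1) * tassoc (comul 1 ⊗ (1 : A));
  counitM_12 : forall a b c : A,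
    counit (a * b * c) =
    \tsum_(x, y <- comul b) counit (a * x) * counit (y * c);
  counitM_21 : forall a b c : A,
    counit (a * b * c) =
    \tsum_(x, y <- comul b) counit (a * y) * counit (x * c);
  antipode_target : forall a : A,
    \tsum_(x, y <- comul a) x * antipode y =
    \tsum_(x, y <- comul 1) counit (x * a) *: y;
  antipode_source : forall a : A,
    \tsum_(x, y <- comul a) antipode x * y =
    \tsum_(x, y <- comul 1) counit (a * y) *: x;
  antipode_conv : forall a : A,
    \tsum_(s, z <- comul a) \tsum_(x, y <- comul s)
      antipode x * y * antipode z = antipode a
}.

#[short(type="weakHopfType")]
HB.structure Definition WeakHopf (F : fieldType) :=
  {A of GRing.Algebra F A & Algebra_isWeakHopf F A}.

Section Connected.
Variables (F : fieldType) (A : weakHopfType F).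

Definition eps_t (a : A) : A := \tsum_(x, y <- comul a) x * antipode y.

Definition target : set A := range eps_t.

Definition target_act (a x : A) : A := eps_t (a * x).

Definition target_submodule (U : set A) : Prop :=
  [/\ U `<=` target, U 0,
      forall (c : F) x y, U x -> U y -> U (c *: x + y) &
      forall a x, U x -> U (target_act a x)].

Definition target_simple : Prop :=
  target <> [set 0] /\
  forall U : set A, target_submodule U -> U = [set 0] \/ U = target.

(* Endomorphisms of the module A_t, as maps on A considered on A_t only. *)
Definition target_endo (f : A -> A) : Prop :=
  [/\ forall x, target x -> target (f x),
      forall (c : F) x y, target x -> target y ->
        f (c *: x + y) = c *: f x + f y &
      forall a x, target x -> f (target_act a x) = target_act a (f x)].

Definition center : set A := [set z | forall a, z * a = a * z].

Definition connected : Prop :=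
  [/\ target_simple,
      center `&` target = range (fun c : F => c%:A) &
      forall f : A -> A, target_endo f <->
        exists c : F, forall x, target x -> f x = c *: x].

End Connected.

Record weak_hopf_hom (F : fieldType) (A B : weakHopfType F)
    (k : {lrmorphism A -> B}) : Prop := WeakHopfHom {
  weak_hopf_hom_comul : forall a, comul (k a) = tmap k k (comul a);
  weak_hopf_hom_counit : forall a, counit (k a) = counit a;
  weak_hopf_hom_antipode : forall a, k (antipode a) = antipode (k a)
}.

Definition birel_mult (F : fieldType) (B : weakHopfType F) (C : algType F)
    (pi : {linear B -> C}) : Prop :=
  forall a b : B,
    \tsum_(x, y <- comul 1) pi (a * antipode x) * pi (y * b) = pi (a * b) /\
    \tsum_(x, y <- comul 1) pi (a * x) * pi (antipode y * b) = pi (a * b).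

Definition trivializes (F : fieldType) (A B : weakHopfType F)
    (k : A -> B) (C : algType F) (pi : {linear B -> C}) : Prop :=
  birel_mult pi /\ forall a : A, pi (k a) = (counit a)%:A.

(* The test algebras are nonzero rings, as everywhere in the library; the zero
   algebra imposes no condition in the universal property. *)
Definition is_cokernel (F : fieldType) (A B : weakHopfType F)
    (k : A -> B) (H : algType F) (pi : {linear B -> H}) : Prop :=
  trivializes k pi /\
  forall (H' : algType F) (pi' : {linear B -> H'}), trivializes k pi' ->
    exists2 g : {lrmorphism H -> H'}, (forall b, pi' b = g (pi b)) &
      forall g' : {lrmorphism H -> H'},
        (forall b, pi' b = g' (pi b)) -> g' =1 g.

(* Main.v *)
Require Import Defs.
From HB Require Import structures.
From mathcomp Require Import all_boot all_order all_algebra.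
From mathcomp Require Import boolp classical_sets.

Set Implicit Arguments.
Unset Strict Implicit.
Unset Printing Implicit Defensive.

Import GRing.Theory.
Local Open Scope ring_scope.

(** The image of [pi] contains [1] and is a subspace, so two things remain: a
    product [pi a * pi b] lies in the image, and the image, once known to be a
    subalgebra, is everything.

    Products.  In the groupoid case two arrows [a] and [b] need not be
    composable, but connectedness of the subgroupoid [A] gives an arrow [h] of
    [A] between them, and [pi a * pi b = pi (a * h * b)] because [pi] sends
    [h] to [1].  In general such a connecting element is provided by Jacobson
    density.  The module [A_t] is simple with scalar endomorphisms, hence some
    [h] in [A] satisfies [eps_t (h * y) = counit y *: 1] for finitely many
    prescribed [y] in [A_t] ([target_density]).  Applying birelative
    multiplicativity on both sides of [k h] gives
      pi (a k(h) b) = pi (a k(S 1_1)) counit (1_2 h S(1'_1)) pi (k(1'_2) b).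
    Since S(1'_1) ⊗ 1'_2 = eps_t(1'_1) ⊗ 1'_2 ([antipode_comul1]) and
    counit (x eps_t(y)) = counit (x y) ([counit_eps_t]), the choice of [h] for
    the [y = eps_t(1'_1)] splits the scalar as counit(1_2) counit(1'_1), and
    the counit axioms with S(1) = 1 reduce the right-hand side to
    [pi a * pi b] ([mul_pi_connecting]).

    Generation.  The subalgebra [im pi], with the corestriction of [pi], is a
    competitor in the universal property; following the resulting map
    [H -> im pi] by the inclusion gives an endomorphism of [H] that fixes [pi],
    hence the identity ([cokernel_generated]). *)

(** * Sums over tensors *)

Section LiftSums.
Variables (F : fieldType) (U V W : lmodType F) (f : U -> V -> W).
Hypothesis f_bilin : bilin f.

Lemma tsum_sum (I : Type) (r : seq I) (t : I -> tensor U V) :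
  tsum f (\sum_(i <- r) t i) = \sum_(i <- r) tsum f (t i).
Proof.
by apply: (big_morph (tsum f)) => [s s'|]; rewrite ?tsumD ?tsum0.
Qed.

Lemma tsum_tmap (U' V' : lmodType F) (g : {linear U' -> U})
    (h : {linear V' -> V}) (t : tensor U' V') :
  tsum f (tmap g h t) = \tsum_(x, y <- t) f (g x) (h y).
Proof. by rewrite tsum_sum; apply: eq_bigr => p _; rewrite tsum_tens. Qed.

Lemma bilin_sumr (I : Type) (r : seq I) u (v : I -> V) :
  f u (\sum_(i <- r) v i) = \sum_(i <- r) f u (v i).
Proof.
apply: (big_morph (f u)) => [w w'|]; first exact: bilinDr f_bilin _ _ _.
exact: bilin0r f_bilin _.
Qed.

Lemma bilin_suml (I : Type) (r : seq I) (u : I -> U) v :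
  f (\sum_(i <- r) u i) v = \sum_(i <- r) f (u i) v.
Proof.
apply: (big_morph (f^~ v)) => [w w'|]; first exact: bilinDl f_bilin _ _ _.
exact: bilin0l f_bilin _.
Qed.

End LiftSums.

Section Trilinear.
Variables (F : fieldType) (U V X W : lmodType F).

Definition trilin (f : U -> V -> X -> W) : Prop :=
  [/\ forall y z, linear (fun x => f x y z),
      forall x z, linear (fun y => f x y z) &
      forall x y, linear (f x y)].

Definition tsum3 (f : U -> V -> X -> W) (t : tensor U (tensor V X)) : W :=
  \tsum_(x, s <- t) tsum (f x) s.

Variable f : U -> V -> X -> W.
Hypothesis f_trilin : trilin f.

Lemma trilin_bilin x : bilin (f x).
Proof. by case: f_trilin => _ f2 f3; split=> [z|y]; [exact: f2|exact: f3]. Qed.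

Lemma tsum_linear_param (P : U -> V -> X -> W) s :
  (forall y z, linear (fun x => P x y z)) -> linear (fun x => tsum (P x) s).
Proof.
move=> Plin c x y; rewrite /tsum scaler_sumr -big_split.
by apply: eq_bigr => p _; rewrite Plin.
Qed.

Lemma tsum3_bilin : bilin (fun x s => tsum (f x) s).
Proof.
case: f_trilin => f1 f2 f3; split=> [s|x] /=.
  exact: tsum_linear_param.
by apply: tsum_linear; exact: trilin_bilin.
Qed.

Lemma tsum3_assoc (s : tensor U V) (z : X) :
  tsum3 f (tassoc (s ⊗ z)) = \tsum_(x, y <- s) f x y z.
Proof.
rewrite /tassoc tsum_tens; last exact: tassoc_bilin1.
rewrite /tsum3 tsum_sum; last exact: tsum3_bilin.
apply: eq_bigr => p _; rewrite tsum_tens; last exact: tsum3_bilin.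
by rewrite tsum_tens //; exact: trilin_bilin.
Qed.

End Trilinear.

Lemma tassoc_tmap (F : fieldType) (U V W X : lmodType F) (g : X -> tensor U V)
    (t : tensor X W) :
  tassoc (tmap g id t) = \sum_(p <- of_tensor t) tassoc (g p.1 ⊗ p.2).
Proof. by rewrite /tassoc tsum_sum //; exact: tassoc_bilin1. Qed.

(** * Weak Hopf algebras *)

Section WeakHopfTheory.
Variables (F : fieldType) (A : weakHopfType F).
Implicit Types (a b c x y : A).

Section Iterated.
Variables (W : lmodType F) (f : A -> A -> A -> W).
Hypothesis f_trilin : trilin f.

Lemma tsum3_comull (t : tensor A A) :
  tsum3 f (tassoc (tmap comul id t)) =
  \tsum_(s, z <- t) \tsum_(x, y <- comul s) f x y z.
Proof.
rewrite tassoc_tmap /tsum3 tsum_sum; last exact: tsum3_bilin.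
by apply: eq_bigr => p _; apply: tsum3_assoc.
Qed.

(** A trilinear map descends to the threefold tensor product, so two iterated
    comultiplications that agree there give the same sums; likewise for
    [tsum_comul1]. *)
Lemma tsum_coassoc a :
  \tsum_(s, z <- comul a) \tsum_(x, y <- comul s) f x y z =
  \tsum_(x, s <- comul a) \tsum_(y, z <- comul s) f x y z.
Proof.
rewrite -tsum3_comull comul_coassoc /tsum3.
rewrite /tmap tsum_sum; last exact: tsum3_bilin.
by apply: eq_bigr => p _; rewrite tsum_tens //; exact: tsum3_bilin.
Qed.

(** In Sweedler notation, 1_1 ⊗ 1_2 ⊗ 1_3 = 1_1 ⊗ 1_2 1'_1 ⊗ 1'_2. *)
Lemma tsum_comul1 :
  \tsum_(s, z <- comul (1 : A)) \tsum_(x, y <- comul s) f x y z =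
  \tsum_(x, y <- comul (1 : A)) \tsum_(y', z <- comul (1 : A)) f x (y * y') z.
Proof.
have E : tassoc (tmap comul id (comul (1 : A))) =
  \sum_(p <- of_tensor (comul (1 : A)))
  \sum_(q <- of_tensor (comul (1 : A))) p.1 ⊗ ((p.2 * q.1) ⊗ q.2).
  rewrite comul1_leftright {1}/tassoc tsum_tens; last exact: tassoc_bilin1.
  rewrite mulr_suml; apply: eq_bigr => p _.
  rewrite [X in _ * (_ ⊗ X)]tensorE.
  have -> : (1 : A) ⊗ (\sum_(q <- of_tensor (comul (1 : A))) q.1 ⊗ q.2) =
     \sum_(q <- of_tensor (comul (1 : A))) (1 : A) ⊗ (q.1 ⊗ q.2).
    apply: (big_morph (fun u => (1 : A) ⊗ u)) => [s s'|].
      exact: (bilinDr (@tens_bilin _ _ _)).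
    exact: (bilin0r (@tens_bilin _ _ _)).
  rewrite mulr_sumr; apply: eq_bigr => q _.
  by rewrite [LHS]tensor_mul_tens [X in _ ⊗ X]tensor_mul_tens mulr1 mul1r.
rewrite -tsum3_comull E /tsum3 tsum_sum; last exact: tsum3_bilin.
apply: eq_bigr => p _; rewrite tsum_sum; last exact: tsum3_bilin.
apply: eq_bigr => q _; rewrite tsum_tens; last exact: tsum3_bilin.
by rewrite tsum_tens //; exact: trilin_bilin.
Qed.

End Iterated.

Lemma eps_t_bilin : bilin (fun x y : A => x * antipode y).
Proof.
split=> [y c u v|x c u v] /=; first by rewrite mulrDl scalerAl.
by rewrite linearP mulrDr scalerAr.
Qed.

Fact eps_t_linear : linear (@eps_t F A).
Proof.
by move=> c a b; rewrite /eps_t linearP tsum_linear //; exact: eps_t_bilin.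
Qed.
HB.instance Definition _ :=
  GRing.isLinear.Build F A A *:%R (@eps_t F A) eps_t_linear.

Lemma eps_tE a : eps_t a = \tsum_(x, y <- comul 1) counit (x * a) *: y.
Proof. exact: antipode_target. Qed.

(** This is the counit axiom counit(x 1 b) = counit(x 1_2) counit(1_1 b). *)
Lemma counit_eps_t x b : counit (x * eps_t b) = counit (x * b).
Proof.
rewrite eps_tE -[X in counit (X * b)]mulr1 counitM_21.
rewrite /tsum mulr_sumr raddf_sum; apply: eq_bigr => p _ /=.
by rewrite -scalerAr linearZ mulrC.
Qed.

Lemma eps_tM a b : eps_t (a * eps_t b) = eps_t (a * b).
Proof.
rewrite [LHS]eps_tE [RHS]eps_tE; apply: eq_bigr => p _.
by rewrite !mulrA counit_eps_t.
Qed.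

Lemma eps_t1 : eps_t (1 : A) = 1.
Proof.
rewrite eps_tE -[RHS]comul_counitl.
by apply: eq_bigr => p _; rewrite mulr1.
Qed.

Lemma eps_t_mul_comul a b :
  eps_t (a * b) = \tsum_(x, y <- comul a) \tsum_(x', y' <- comul b)
    (x * x') * antipode (y * y').
Proof.
rewrite /eps_t comulM [LHS]tsum_sum; last exact: eps_t_bilin.
apply: eq_bigr => p _; rewrite tsum_sum; last exact: eps_t_bilin.
by apply: eq_bigr => q _; rewrite tsum_tens //; exact: eps_t_bilin.
Qed.

Section EpsTargetComul1.
Variables (W : lmodType F) (f : A -> A -> W).
Hypothesis f_bilin : bilin f.

(** The legs 1_2 behave like elements of [A_t], on which [eps_t] is linear from
    the left: 1_1 ⊗ Delta(1_2) = 1_1 ⊗ 1_2 1'_1 ⊗ 1'_2 gives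
    1_1 ⊗ Delta(1_2 a) = 1_1 ⊗ 1_2 a_1 ⊗ a_2, to which the antipode formula for
    [eps_t] applies. *)
Lemma eps_t_comul1M a :
  \tsum_(x, y <- comul 1) f x (eps_t (y * a)) =
  \tsum_(x, y <- comul 1) f x (y * eps_t a).
Proof.
pose g x u v := f x (\tsum_(u', v' <- comul a) (u * u') * antipode (v * v')).
have g_trilin : trilin g.
  split=> [u v c x x'|x v c u u'|x u c v v'].
  - exact: (f_bilin.1 _ c x x').
  - rewrite /g -(f_bilin.2 x c); congr f; rewrite /tsum scaler_sumr -big_split.
    by apply: eq_bigr => p _ /=; rewrite !mulrDl -!scalerAl.
  - rewrite /g -(f_bilin.2 x c); congr f; rewrite /tsum scaler_sumr -big_split.
    apply: eq_bigr => p _ /=.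
    by rewrite mulrDl -scalerAl linearP mulrDr -scalerAr.
transitivity (\tsum_(x, s <- comul 1) \tsum_(u, v <- comul s) g x u v).
  apply: eq_bigr => p _; rewrite eps_t_mul_comul.
  by rewrite [X in f _ X]/tsum bilin_sumr.
rewrite -tsum_coassoc // tsum_comul1 //; apply: eq_bigr => p _.
rewrite -[a in RHS]mul1r eps_t_mul_comul [X in _ * X]/tsum mulr_sumr.
rewrite bilin_sumr //; apply: eq_bigr => q _; congr f.
by rewrite /tsum mulr_sumr; apply: eq_bigr => r _; rewrite !mulrA.
Qed.

Lemma eps_t_comul1 :
  \tsum_(x, y <- comul 1) f x (eps_t y) = \tsum_(x, y <- comul 1) f x y.
Proof.
transitivity (\tsum_(x, y <- comul 1) f x (y * eps_t 1)); last first.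
  by apply: eq_bigr => p _; rewrite eps_t1 mulr1.
rewrite -[RHS]eps_t_comul1M.
by apply: eq_bigr => p _; rewrite mulr1.
Qed.

End EpsTargetComul1.

(** The axiom S(a_1) a_2 S(a_3) = S(a), read with the last two factors
    gathered. *)
Lemma antipodeE a : antipode a = \tsum_(x, y <- comul a) antipode x * eps_t y.
Proof.
rewrite -antipode_conv tsum_coassoc; last first.
  split=> [y z c u v|x z c u v|x y c u v].
  - by rewrite linearP !mulrDl -!scalerAl.
  - by rewrite mulrDr mulrDl -scalerAr -scalerAl.
  - by rewrite linearP mulrDr -scalerAr.
apply: eq_bigr => p _; rewrite /eps_t /tsum mulr_sumr.
by apply: eq_bigr => q _; rewrite mulrA.
Qed.

Lemma eps_s_bilin : bilin (fun x y : A => antipode x * y).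
Proof.
split=> [y c u v|x c u v] /=; first by rewrite linearP mulrDl scalerAl.
by rewrite mulrDr scalerAr.
Qed.

Lemma eps_s1 : \tsum_(x, y <- comul 1) antipode x * y = 1 :> A.
Proof.
rewrite antipode_source -[RHS]comul_counitr.
by apply: eq_bigr => p _; rewrite mul1r.
Qed.

Lemma antipode1 : antipode 1 = 1 :> A.
Proof. by rewrite antipodeE -[RHS]eps_s1; exact: eps_t_comul1 eps_s_bilin. Qed.

(** On the left legs of Delta(1) the antipode takes values in [A_t]:
    S(1_1) ⊗ 1_2 = S(1_1) eps_t(1_2 1'_1) ⊗ 1'_2
                 = S(1_1) 1_2 eps_t(1'_1) ⊗ 1'_2 = eps_t(1'_1) ⊗ 1'_2.
    This route avoids antimultiplicativity of the antipode. *)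
Lemma antipode_comul1 (W : lmodType F) (f : A -> A -> W) : bilin f ->
  \tsum_(x, y <- comul 1) f (antipode x) y =
  \tsum_(x, y <- comul 1) f (eps_t x) y.
Proof.
move=> f_bilin.
pose g x y z := f (antipode x * eps_t y) z.
have g_trilin : trilin g.
  split=> [y z c u v|x z c u v|x y c u v].
  - by rewrite /g -(f_bilin.1 z c) linearP mulrDl -scalerAl.
  - by rewrite /g -(f_bilin.1 z c) linearP mulrDr -scalerAr.
  - exact: (f_bilin.2 _ c u v).
transitivity (\tsum_(s, z <- comul 1) \tsum_(x, y <- comul s) g x y z).
  by apply: eq_bigr => p _; rewrite antipodeE [X in f X _]/tsum bilin_suml.
rewrite tsum_comul1 // /tsum exchange_big; apply: eq_bigr => q _ /=.
rewrite -[eps_t q.1 in RHS]mul1r -[in RHS]eps_s1 [in RHS]/tsum.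
rewrite mulr_suml bilin_suml //.
have h_bilin : bilin (fun x y => f (antipode x * y) q.2).
  split=> [y c u v|x c u v] /=; rewrite -(f_bilin.1 _ c).
    by rewrite linearP mulrDl -scalerAl.
  by rewrite mulrDr -scalerAr.
apply: etrans (eps_t_comul1M h_bilin q.1) _.
by apply: eq_bigr => p _; rewrite mulrA.
Qed.

End WeakHopfTheory.

(** * Density for the target module *)

Section Density.
Variables (F : fieldType) (A : weakHopfType F).
Local Open Scope classical_set_scope.

Lemma target_act_linearl (x : A) : linear (fun a => target_act a x).
Proof. by move=> c a b; rewrite /target_act mulrDl -scalerAl linearP. Qed.

Lemma target_act_linearr (a : A) : linear (target_act a).
Proof. by move=> c x y; rewrite /target_act mulrDr -scalerAr linearP. Qed.

HB.instance Definition _ a :=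
  GRing.isLinear.Build F A A *:%R (target_act a) (target_act_linearr a).

Lemma target_actA (a b x : A) :
  target_act a (target_act b x) = target_act (a * b) x.
Proof. by rewrite /target_act eps_tM mulrA. Qed.

Lemma target_act1 (x : A) : target x -> target_act 1 x = x.
Proof. by case=> a _ <-; rewrite /target_act eps_tM mul1r. Qed.

Lemma target_lin c (x y : A) : target x -> target y -> target (c *: x + y).
Proof.
by case=> a _ <- [b _ <-]; exists (c *: a + b) => //; rewrite linearP.
Qed.

Lemma target_act_target (a x : A) : target (target_act a x).
Proof. by exists (a * x). Qed.

Definition annih (s : seq A) : set A :=
  [set a | forall y, y \in s -> target_act a y = 0].

Fixpoint in_span (s : seq A) (x : A) : Prop :=
  if s is y :: s' then exists c : F, in_span s' (x - c *: y) else x = 0.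

Lemma annih_lin s c a b : annih s a -> annih s b -> annih s (c *: a + b).
Proof.
move=> sa sb y ys; rewrite target_act_linearl sa // sb //.
by rewrite scaler0 addr0.
Qed.

Lemma annihMl s a b : annih s b -> annih s (a * b).
Proof.
by move=> sb y ys; rewrite -target_actA sb // /target_act mulr0 linear0.
Qed.

Lemma annih_cons s y a :
  annih (y :: s) a <-> target_act a y = 0 /\ annih s a.
Proof.
split=> [sa|[ya sa] z].
  by split=> [|z zs]; apply: sa; rewrite inE ?eqxx ?zs ?orbT.
by rewrite inE => /predU1P[-> //|]; apply: sa.
Qed.

Lemma annih_orbit_submodule s m :
  target_submodule ((fun a => target_act a m) @` annih s).
Proof.
split=> [_ [a _ <-]||c _ _ [a sa <-] [b sb <-]|a _ [b sb <-]].
- exact: target_act_target.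
- by exists 0 => [y _|]; rewrite /target_act mul0r linear0.
- by exists (c *: a + b); [exact: annih_lin|exact: target_act_linearl].
- by exists (a * b); [exact: annihMl|rewrite target_actA].
Qed.

Hypothesis A_conn : connected A.

(** The orbit of [m] under the left ideal [annih s] is a submodule of the simple
    module [A_t]. *)
Lemma annih_orbit s m :
  ~ (forall a, annih s a -> target_act a m = 0) ->
  forall z, target z -> exists2 a, annih s a & target_act a m = z.
Proof.
move=> nm z zt; have [[_ simpleA] _ _] := A_conn.
have [E|E] := simpleA _ (annih_orbit_submodule s m); last first.
  by have : ((fun a => target_act a m) @` annih s) z by rewrite E.
exfalso; apply: nm => a sa.
have : ((fun a => target_act a m) @` annih s) (target_act a m) by exists a.
by rewrite E.
Qed.

(** Double annihilator property, by induction on [s = y :: s'].  If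
    [annih s'] does not kill [y], then [annih s'] moves [y] everywhere in [A_t],
    and [a . y |-> a . m] for [a] in [annih s'] is an endomorphism of [A_t],
    well defined because an element of [annih s'] that kills [y] kills [m].
    It is a scalar [c], so [annih s'] kills [m - c *: y] and induction
    applies. *)
Lemma annih_span s m : (forall y, y \in s -> target y) -> target m ->
  (forall a, annih s a -> target_act a m = 0) -> in_span s m.
Proof.
elim: s m => [|y s IHs] m st mt sm /=.
  by rewrite -[m]target_act1 // sm.
have {}IHs := IHs _ (fun z zs => st z (mem_behead (s := y :: s) zs)).
have yt : target y by apply: st; rewrite mem_head.
have [sy|nsy] := pselect (forall a, annih s a -> target_act a y = 0).
  exists 0; rewrite scale0r subr0; apply: IHs => // a sa.
  by apply: sm; apply/annih_cons; split=> //; apply: sy.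
have orbit_y := annih_orbit nsy.
have ex z : exists a, target z -> annih s a /\ target_act a y = z.
  have [zt|nzt] := pselect (target z); last by exists 0.
  by have [a sa az] := orbit_y z zt; exists a.
pose h z := sval (cid (ex z)).
have hP z : target z -> annih s (h z) /\ target_act (h z) y = z.
  exact: svalP (cid (ex z)).
pose f z := target_act (h z) m.
have f_act a : annih s a -> f (target_act a y) = target_act a m.
  move=> sa; have [sh hy] := hP _ (target_act_target a y).
  apply/eqP; rewrite -subr_eq0 addrC -scaleN1r -target_act_linearl.
  apply/eqP/sm/annih_cons; split; last exact: annih_lin.
  by rewrite target_act_linearl hy scaleN1r addNr.
have [_ _ /(_ f)[endo_scalar _]] := A_conn.
have [|c fc] := endo_scalar.
  split=> [z zt|c z z' zt zt'|a z zt]; first exact: target_act_target.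
    have [sh hy] := hP z zt; have [sh' hy'] := hP z' zt'.
    rewrite -{1}hy -{1}hy' -target_act_linearl f_act; last exact: annih_lin.
    exact: target_act_linearl.
  have [sh hy] := hP z zt.
  rewrite -{1}hy target_actA f_act; last exact: annihMl.
  by rewrite -target_actA.
exists c; rewrite addrC -scaleNr; apply: IHs => [|a sa].
  exact: target_lin.
rewrite target_act_linearr -(f_act a) // fc; last exact: target_act_target.
by rewrite scaleNr addNr.
Qed.

Lemma eq_in_span (f g : {linear A -> A}) s x :
  (forall y, y \in s -> f y = g y) -> in_span s x -> f x = g x.
Proof.
elim: s x => [|y s IHs] x fg /=; first by move=> ->; rewrite !linear0.
case=> c sx; have fgs z : z \in s -> f z = g z.
  by move=> zs; apply: fg; rewrite inE zs orbT.
have := IHs _ fgs sx; rewrite !linearB !linearZ /= (fg y) ?mem_head //.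
exact: addIr.
Qed.

(** Jacobson density: one element of [A] interpolates a linear map of [A_t] at
    finitely many points.  At each new point [y] that is not forced by linearity,
    the value is corrected by an element of the annihilator of the earlier
    points. *)
Lemma target_density (f : {linear A -> A}) (s : seq A) :
  (forall x, target x -> target (f x)) -> (forall y, y \in s -> target y) ->
  exists a, forall y, y \in s -> target_act a y = f y.
Proof.
move=> ft; elim: s => [|y s IHs] st; first by exists 0.
have ys : target y by apply: st; rewrite mem_head.
have {}st z : z \in s -> target z by move=> zs; apply: st; rewrite inE zs orbT.
have [a sa] := IHs st.
have [sy|nsy] := pselect (forall b, annih s b -> target_act b y = 0).
  exists a => z; rewrite inE => /predU1P[->|/sa //].
  by apply: (@eq_in_span _ _ s) => //; apply: annih_span.
have [|b sb by_] := annih_orbit nsy (z := f y - target_act a y).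
  rewrite addrC -scaleN1r; apply: target_lin; first exact: target_act_target.
  exact: ft.
exists (1 *: b + a) => z; rewrite inE target_act_linearl scale1r.
by case/predU1P=> [->|zs]; rewrite ?by_ ?subrK // sb // add0r sa.
Qed.
End Density.

(** * Cokernels are generated by the image *)

Section Subalgebra.
Variables (F : fieldType) (H : algType F) (S : subalgClosed H).

Record subalg := Subalg { subalg_val : H; _ : subalg_val \in S}.
HB.instance Definition _ := [isSub for subalg_val].
HB.instance Definition _ := [Choice of subalg by <:].
HB.instance Definition _ := [SubChoice_isSubAlgebra of subalg by <:].
HB.instance Definition _ :=
  GRing.RMorphism.copy subalg_val (\val : subalg -> H).
HB.instance Definition _ :=
  GRing.Linear.copy subalg_val (\val : subalg -> H).
End Subalgebra.

(** A subalgebra containing the image receives a map from [H] by universality;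
    its composite with the inclusion agrees with the identity on the image. *)
Lemma cokernel_generated (F : fieldType) (A B : weakHopfType F) (k : A -> B)
    (H : algType F) (pi : {linear B -> H}) (S : subalgClosed H) :
  is_cokernel k pi -> (forall b, pi b \in S) -> forall x, x \in S.
Proof.
move=> [[pi_mult pi_triv] pi_univ] piS x.
pose pi0 b : subalg S := Subalg (piS b).
have pi0_linear : linear pi0.
  by move=> c a b; apply: val_inj; rewrite /= linearP.
pose pi0M := GRing.isLinear.Build F B (subalg S) *:%R pi0 pi0_linear.
pose pi' : {linear B -> subalg S} := HB.pack pi0 pi0M.
have pi'_triv : trivializes k pi'.
  split=> [a b|a]; last by apply: val_inj; rewrite /= pi_triv.
  have [Ml Mr] := pi_mult a b.
  split; apply: val_inj.
    by apply: etrans Ml; exact: (raddf_sum (\val : {additive subalg S -> H})).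
  by apply: etrans Mr; exact: (raddf_sum (\val : {additive subalg S -> H})).
have [g gpi _] := pi_univ _ _ pi'_triv.
have [h _ h_uniq] := pi_univ _ _ (conj pi_mult pi_triv).
have vgE : (@subalg_val F H S \o g : {lrmorphism H -> H}) =1 h.
  by apply: h_uniq => b /=; rewrite -gpi.
have idE : (idfun : {lrmorphism H -> H}) =1 h by apply: h_uniq.
by rewrite -[x]/(idfun x) idE -vgE /=; apply: valP.
Qed.

(** * Products of values of the cokernel map *)

Section Cokernel.
Variables (F : fieldType) (A B : weakHopfType F) (k : {lrmorphism A -> B}).
Variables (H : algType F) (pi : {linear B -> H}).
Hypotheses (k_hom : weak_hopf_hom k) (A_conn : connected A).
Hypothesis pi_triv : trivializes k pi.

Lemma tsum_comul1_hom (W : lmodType F) (f : B -> B -> W) : bilin f ->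
  \tsum_(x, y <- comul 1) f x y = \tsum_(x, y <- comul 1) f (k x) (k y).
Proof.
by move=> f_bilin; rewrite -(rmorph1 k) (weak_hopf_hom_comul k_hom) tsum_tmap.
Qed.

(** The element [h] plays the role of an arrow joining the source of [a] to the
    target of [b], for all [a] and [b] at once. *)
Lemma mul_pi_connecting :
  exists h : A, forall a b, pi a * pi b = pi (a * k h * b).
Proof.
pose t := of_tensor (comul (1 : A)).
pose f (x : A) : A := counit x *: 1.
have f_linear : linear f by move=> c x y; rewrite /f linearP scalerDl scalerA.
pose fM := GRing.isLinear.Build F A A *:%R f f_linear.
pose fL : {linear A -> A} := HB.pack f fM.
have ft x : target x -> target (fL x).
  move=> _; exists (counit x *: 1) => //.
  by rewrite linearZ /= eps_t1.
have [y|h hP] := @target_density _ _ A_conn fL [seq eps_t p.1 | p <- t] ft.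
  by case/mapP=> p _ ->; exists p.1.
exists h => a b; have [pi_mult pi_k] := pi_triv.
(* Delta(1) of [B] comes from [A], so cutting [c * d] by birelative
   multiplicativity inserts elements of [k A] only. *)
have pi_split c d : pi (c * d) =
    \tsum_(x, y <- comul 1) pi (c * k (antipode x)) * pi (k y * d).
  rewrite -(pi_mult c d).1 tsum_comul1_hom; last first.
    split=> [y e u v|x e u v] /=; last first.
      by rewrite mulrDl -scalerAl linearP mulrDr -scalerAr.
    by rewrite linearP mulrDr -scalerAr linearP mulrDl -scalerAl.
  by apply: eq_bigr => p _ /=; rewrite (weak_hopf_hom_antipode k_hom).
(* The right cut: the defining property of [h] detaches it from [x]. *)
have counit_h x :
    \tsum_(y, z <- comul 1) counit (x * h * antipode y) *: pi (k z * b) =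
    counit x *: pi b.
  rewrite (antipode_comul1 (f := fun y z => counit (x * h * y) *: pi (k z * b))).
    rewrite -[b in RHS]mul1r -(rmorph1 k) -[1 in RHS]comul_counitl.
    rewrite [in RHS]/tsum.
    rewrite raddf_sum mulr_suml raddf_sum scaler_sumr.
    apply: eq_big_seq => p tp; rewrite /= [k (_ *: _)]linearZ /=.
    rewrite -scalerAl linearZ scalerA /=.
    congr (_ *: _).
    rewrite -mulrA -counit_eps_t [eps_t _]hP; last by apply/mapP; exists p.
    rewrite /= /f -scalerAr mulr1 linearZ /= mulrC; congr (_ * _).
    by rewrite -[eps_t _]mul1r counit_eps_t mul1r.
  split=> [z c u v|y c u v] /=; last first.
    by rewrite linearP mulrDl -scalerAl linearP scalerDr !scalerA mulrC.
  by rewrite mulrDr -scalerAr linearP scalerDl scalerA.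
rewrite -mulrA pi_split.
(* The left cut: [a] is rewritten as a * k (S(1_1 counit(1_2))). *)
transitivity
    (\tsum_(x, y <- comul 1) pi (a * k (antipode x)) * (counit y *: pi b)).
  rewrite -[a in LHS]mulr1 -(rmorph1 k) -[1 in LHS]antipode1.
  rewrite -[1 in LHS]comul_counitr [in LHS]/tsum !raddf_sum mulr_sumr.
  rewrite raddf_sum mulr_suml.
  apply: eq_bigr => p _; rewrite /= linearZ [k (_ *: _)]linearZ /=.
  rewrite -scalerAr linearZ /=.
  by rewrite -scalerAl -scalerAr.
apply: eq_bigr => p _; congr (_ * _); rewrite -counit_h mulrA pi_split.
apply: eq_bigr => q _; rewrite -!rmorphM pi_k /=.
by rewrite mulr_algl.
Qed.

End Cokernel.

Theorem proposition3p7 (F : fieldType) (A B : weakHopfType F)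
    (k : {lrmorphism A -> B}) (H : algType F) (pi : {linear B -> H}) :
  weak_hopf_hom k -> connected A -> is_cokernel k pi ->
  range pi = [set: H]%classic.
Proof.
move=> k_hom A_conn pi_coker; have [pi_triv _] := pi_coker.
have [h hP] := mul_pi_connecting k_hom A_conn pi_triv.
pose im : {pred H} := fun x => `[< exists b, pi b = x >].
have imP x : reflect (exists b, pi b = x) (x \in im) by exact: asboolP.
(* If the counit vanished, the counit axiom would give 1 = 0 in [A]. *)
have im1 : 1 \in im.
  have [a ea] : exists a : A, counit a = 1 :> F.
    apply: contrapT => nea; have c0 (a : A) : counit a = 0 :> F.
      apply: contrapT => /eqP ca; apply: nea; exists ((counit a)^-1 *: a).
      by rewrite linearZ /= mulVf.
    have /eqP := comul_counitl (1 : A); rewrite eq_sym /tsum big1 ?oner_eq0 //.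
    by move=> p _; rewrite c0 scale0r.
  by apply/imP; exists (k a); rewrite pi_triv.2 ea scale1r.
have im_subalg : subalg_closed im.
  split=> // [c _ _ /imP[b <-] /imP[d <-]|_ _ /imP[b <-] /imP[d <-]].
    by apply/imP; exists (c *: b + d); rewrite linearP.
  by apply/imP; exists (b * k h * d); rewrite hP.
pose imM :=
  GRing.isSubalgClosed.Build F H im (GRing.subalg_closed_semi im_subalg).
pose S : subalgClosed H := HB.pack im imM.
apply/seteqP; split=> // x _.
have /imP[b <-] : x \in im; last by exists b.
by apply: (cokernel_generated (S := S) pi_coker) => b; apply/imP; exists b.
Qed.
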